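(* Let $B:\mathbb{R}^n\to\mathbb{R}$ be a control Barrier function for the system $\dot x=f(x)+g(x)u$ with input set $\mathcal{U}=\{u\in\mathbb{R}^m: Au+b\le 0\}$, with associated sets $\mathcal{B}=\{x\in\mathbb{R}^n: B(x)\ge 0\}\subseteq\mathcal{C}\subset\mathbb{R}^n$, and let $\alpha$ be an extended class-$\mathcal{K}$ function. Let $u^{\mathrm{des}}(x)\in\mathcal{U}$ be a given nominal controller. Assume that $\mathcal{L}_gB(x)\neq 0$ for $x\in\mathcal{C}$ (relative degree one) and that the problem is primal non-degenerate on $\mathcal{C}$. For $x\in\mathcal{C}$ consider the quadratic program $$\min_{u\in\mathbb{R}^m}\ \tfrac12\|u-u^{\mathrm{des}}(x)\|_2^2\quad\text{subject to}\quad \mathcal{L}_fB(x)+\mathcal{L}_gB(x)u+\alpha(B(x))\ge 0,\qquad Au+b\le 0,$$ and let $u^*(x)$ denote its minimizer. Suppose that this problem is feasible for every $x\in\mathcal{C}$. Then the optimal control law $x\mapsto u^*(x)$ is locally Lipschitz continuous in $\mathcal{C}$.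
   Context: The system is $\dot x=f(x)+g(x)u$ with $x\in\mathbb{R}^n$, $u\in\mathcal{U}\subset\mathbb{R}^m$, where $f:\mathbb{R}^n\to\mathbb{R}^n$ and $g:\mathbb{R}^n\to\mathbb{R}^{n\times m}$ are Lipschitz continuous. The input set is $\mathcal{U}=\{u\in\mathbb{R}^m: Au+b\le 0\}$ (componentwise inequality) with $A\in\mathbb{R}^{p\times m}$, $b\in\mathbb{R}^p$. An extended class-$\mathcal{K}$ function is a continuous, strictly increasing function $\alpha:(-c,d)\to(-\infty,+\infty)$ with $c,d>0$ and $\alpha(0)=0$ (its domain is understood to contain the values $B(x)$, $x\in\mathcal{C}$). Lie derivatives: $\mathcal{L}_fB(x)=\frac{\partial B(x)}{\partial x}f(x)\in\mathbb{R}$ and $\mathcal{L}_gB(x)=\frac{\partial B(x)}{\partial x}g(x)\in\mathbb{R}^{1\times m}$. A continuously differentiable $B:\mathbb{R}^n\to\mathbb{R}$ is a control Barrier function for the set $\mathcal{B}$ if there exist an extended class-$\mathcal{K}$ function $\alpha$ and a set $\mathcal{C}$ with $\mathcal{B}\subseteq\mathcal{C}\subset\mathbb{R}^n$ such that for every $x\in\mathcal{C}$, $\sup_{u\in\mathcal{U}}[\mathcal{L}_fB(x)+\mathcal{L}_gB(x)u+\alpha(B(x))]\ge 0$. Here $\mathcal{B}$ is the zero-super level set of $B$. Primal non-degenerate on $\mathcal{C}$ means: for each $x\in\mathcal{C}$, the gradients with respect to $u$ of the constraints active at $u^*(x)$ (that is, $\mathcal{L}_gB(x)$ if the Barrier constraint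 holds with equality, together with the rows $A_i$ of $A$ for which $A_iu^*(x)+b_i=0$) are linearly independent.
   Formalization: The formal theorem additionally assumes that the gradient of B and the nominal controller u^des are locally Lipschitz on C and that α is locally Lipschitz on its domain; without these the claim fails (e.g. B(x)=x, f=0, g=1, u^des=0, α(s)=s^{1/3}). *)

(* Defs.v *)
(* MathComp-Analysis. *)
From HB Require Import structures.
From mathcomp Require Import all_boot all_order all_algebra.
From mathcomp Require Import all_classical all_reals all_analysis.

Set Implicit Arguments.
Unset Strict Implicit.
Unset Printing Implicit Defensive.

Import Order.TTheory GRing.Theory Num.Theory.
Import numFieldNormedType.Exports.

Local Open Scope classical_set_scope.
Local Open Scope ring_scope.

Section Analysis.
Context {R : realType}.

Definition grad n (B : 'cV[R]_n -> R) (x : 'cV[R]_n) : 'rV[R]_n :=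
  \row_i 'D_(delta_mx i 0) B x.

Definition continuously_differentiable n (B : 'cV[R]_n -> R) : Prop :=
  (forall x, differentiable B x) /\ continuous (grad B).

(* The endpoints may be infinite, so that functions defined on the whole line
   are covered. *)
Definition open_dom (c d : \bar R) : set R := [set s | (- c < s%:E < d)%E].

(* [alpha] is a total function; its values outside the domain are never
   constrained. *)
Definition extended_class_K (c d : \bar R) (alpha : R -> R) : Prop :=
  [/\ (0 < c)%E, (0 < d)%E,
      {within open_dom c d, continuous alpha},
      (forall s t, open_dom c d s -> open_dom c d t ->
         s < t -> alpha s < alpha t)
    & alpha 0 = 0].

End Analysis.

Section Control.
Context {R : realType} {n m p : nat}.
Implicit Types (f : 'cV[R]_n -> 'cV[R]_n) (g : 'cV[R]_n -> 'M[R]_(n, m)).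
Implicit Types (B : 'cV[R]_n -> R) (alpha : R -> R).
Implicit Types (udes : 'cV[R]_n -> 'cV[R]_m).
Implicit Types (A : 'M[R]_(p, m)) (b : 'cV[R]_p).
Implicit Types (C : set 'cV[R]_n) (U : set 'cV[R]_m).
Implicit Types (x : 'cV[R]_n) (u v : 'cV[R]_m).

Definition input_set A b : set 'cV[R]_m :=
  [set u | forall i, (A *m u + b) i 0 <= 0].

Definition lie_f f B x : R := (grad B x *m f x) 0 0.
Definition lie_g g B x : 'rV[R]_m := grad B x *m g x.

Definition barrier_lhs f g B alpha x u : R :=
  lie_f f B x + (lie_g g B x *m u) 0 0 + alpha (B x).

Definition zero_superlevel B : set 'cV[R]_n := [set x | 0 <= B x].

(* [B] is a control barrier function for its zero-superlevel set, with [C] as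
   the witnessing superset. *)
Definition control_barrier_function f g U B C : Prop :=
  [/\ continuously_differentiable B,
      zero_superlevel B `<=` C
    & exists c d alpha,
        [/\ extended_class_K c d alpha,
            (forall x, C x -> open_dom c d (B x))
          & forall x, C x ->
              (0 <= ereal_sup [set (barrier_lhs f g B alpha x u)%:E | u in U])%E]].

Definition qp_objective udes x u : R :=
  2^-1 * \sum_i (u i 0 - udes x i 0) ^+ 2.

Definition qp_feasible f g A b B alpha x : set 'cV[R]_m :=
  [set u | 0 <= barrier_lhs f g B alpha x u /\ input_set A b u].

Definition qp_minimizer f g A b B alpha udes x : set 'cV[R]_m :=
  [set u | qp_feasible f g A b B alpha x u /\
     forall v, qp_feasible f g A b B alpha x v ->
       qp_objective udes x u <= qp_objective udes x v].

(* The default value 0 is only used where there is no minimizer. *)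
Definition qp_law f g A b B alpha udes x : 'cV[R]_m :=
  xget 0 (qp_minimizer f g A b B alpha udes x).

(* The constraints are indexed by [option 'I_p]: [None] is the barrier
   constraint and [Some i] is the [i]-th row of [A u + b <= 0]. *)
Definition active_constraints f g A b B alpha x u : {set option 'I_p} :=
  [set k | match k with
           | None => barrier_lhs f g B alpha x u == 0
           | Some i => (A *m u + b) i 0 == 0
           end].

Definition constraint_grad g A B x (k : option 'I_p) : 'rV[R]_m :=
  if k is Some i then row i A else lie_g g B x.

(* [free] sees the active gradients as a family, so two equal gradients are
   linearly dependent. *)
Definition primal_nondegenerate f g A b B alpha udes C : Prop :=
  forall x, C x ->
    free [seq constraint_grad g A B x k
         | k in active_constraints f g A b B alpha x
                  (qp_law f g A b B alpha udes x)].

End Control.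

(* Main.v *)
Require Import Defs.
From mathcomp Require Import all_boot all_order all_algebra.
From mathcomp Require Import all_classical all_reals all_analysis.
From mathcomp Require Import ring lra.

Set Implicit Arguments.
Unset Strict Implicit.
Unset Printing Implicit Defensive.

Import Order.TTheory GRing.Theory Num.Theory.
Import numFieldNormedType.Exports.

Local Open Scope classical_set_scope.
Local Open Scope ring_scope.

(** Write [a = lie_g g B], [h = lie_f f B + alpha \o B] and let [U] be the
    polyhedron [A u + b <= 0].  The optimal input at [x] is the Euclidean
    projection of [udes x] onto [U] cut by the half-space
    [a x * u + h x >= 0], and the data [a], [h], [udes] are locally Lipschitz on
    [C].  So the claim concerns projections onto convex sets that depend on a
    parameter.

    Only the barrier constraint moves with [x], so it is the only one that gets a
    multiplier; [U] is kept as an abstract convex set.  If some point of [U]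
    satisfies the barrier constraint strictly, then there is [mu >= 0],
    complementary to the barrier slack, with
    [<u - udes x, v - u> >= mu * a x (v - u)] for all [v] in [U]
    ([kkt_exists]).  Comparing these conditions at two parameters [x], [y]
    gives, with [d = |x - y|] and [s = |u x - u y|],
    [s ^ 2 <= K * d * (s + |mu x - mu y|)] ([kkt_distance]).

    Near [x0] the strictly feasible point persists, so [u] and [mu] are bounded,
    and this inequality already makes [u] continuous at [x0], with a
    Hoelder exponent 1/2.  To improve the exponent the multipliers have to be
    controlled.  If the barrier constraint is inactive at [x0], continuity keeps it
    inactive nearby and [mu = 0].  If it is active, linear independence of the
    active gradients yields a vector [w] with [a x0 * w = 1] that is
    orthogonal to the active rows of [A] ([free_dual_vector]).  By continuity of
    [u], one can move from [u x] inside [U] by a fixed amount along both [w]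
    and [- w] for every [x] near [x0] ([active_direction_feasible]); the
    multiplier inequality is then an equality along [w], which expresses [mu] in
    terms of [u], [udes] and [a], so that [|mu x - mu y| <= N * (s + d)]
    ([multiplier_lipschitz]).  Now [s ^ 2 <= K' * d * (s + d)], and therefore
    [s <= (K' + 1) * d].

    Linear independence also produces the strictly feasible point: when the barrier
    is active at [x0], move slightly along [w] ([slater_point]). *)

(** * Norms of matrices and of their products *)

Section MatrixNorm.
Context {R : realType}.

Lemma ler_entry_norm p q (M : 'M[R]_(p, q)) i j : `|M i j| <= `|M|.
Proof.
rewrite [leRHS]/Num.norm /= mx_normrE.
by apply: (le_bigmax _ (fun ij : 'I_p * 'I_q => `|M ij.1 ij.2|) (i, j)).
Qed.

Lemma norm_mx_le p q (M : 'M[R]_(p, q)) e :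
  0 <= e -> (forall i j, `|M i j| <= e) -> `|M| <= e.
Proof.
move=> e0 Me; rewrite [leLHS]/Num.norm /= mx_normrE.
by apply/bigmax_leP; split => // ij _; exact: Me.
Qed.

Lemma ler_norm_mulmx p q s (M : 'M[R]_(p, q)) (N : 'M[R]_(q, s)) :
  `|M *m N| <= q%:R * `|M| * `|N|.
Proof.
apply: norm_mx_le => [|i j]; first by rewrite !mulr_ge0.
rewrite mxE (le_trans (ler_norm_sum _ _ _))//.
have -> : q%:R * `|M| * `|N| = \sum_(k < q) `|M| * `|N|.
  by rewrite sumr_const card_ord -mulrA mulr_natl.
rewrite ler_sum// => k _; rewrite normrM.
by rewrite ler_pM// ler_entry_norm.
Qed.

Lemma norm_trmx p q (M : 'M[R]_(p, q)) : `|M^T| = `|M|.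
Proof.
have le_tr s t (N : 'M[R]_(s, t)) : `|N^T| <= `|N|.
  by apply: norm_mx_le => // i j; rewrite mxE ler_entry_norm.
by apply/le_anti; rewrite le_tr -{1}[M]trmxK le_tr.
Qed.

End MatrixNorm.

(** * Local Lipschitz continuity relative to a set *)

Section LocalLipschitz.
Context {R : realType}.
Implicit Types V W : normedModType R.

(** A one-point form of the library notion, with explicit radius and constant so
    that finitely many of them can be combined. *)
Definition lipschitz_at V W (D : set V) (F : V -> W) (x0 : V) :=
  exists r K, [/\ 0 < r, 0 <= K & forall x y, D x -> D y ->
    `|x - x0| < r -> `|y - x0| < r -> `|F x - F y| <= K * `|x - y|].

Lemma lipschitz_at_bounded V W (D : set V) (F : V -> W) x0 :
  D x0 -> lipschitz_at D F x0 ->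
  exists r M, [/\ 0 < r, 0 <= M & forall x, D x -> `|x - x0| < r -> `|F x| <= M].
Proof.
move=> Dx0 [r [K [r0 K0 FK]]]; exists r, (`|F x0| + K * r); split => //.
  by rewrite addr_ge0// mulr_ge0// ltW.
move=> x Dx xr; rewrite -[F x](subrK (F x0)) addrC (le_trans (ler_normD _ _))//.
rewrite lerD2l (le_trans (FK _ _ _ _ _ _))// ?subrr ?normr0//.
by rewrite ler_wpM2l// ltW.
Qed.

(** The library localises at pairs [(x0, y0)] of the product, which need not lie
    on the diagonal.  Off the diagonal the bound is automatic: there [|x - y|]
    stays away from 0 while [F] is bounded near each of the two points. *)
Lemma locally_lipschitzP V W (D : set V) (F : V -> W) :
  [locally [lipschitz F x | x in D]] <->
  forall x0, D x0 -> lipschitz_at D F x0.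
Proof.
split=> [F_lip x0 Dx0|F_lip [x0 y0] [/= Dx0 Dy0]].
  have /pinfty_ex_gt0[K K0] := F_lip (x0, x0) (conj Dx0 Dx0).
  rewrite /dominated_by /within /= => -[[S T] /= [/nbhs_normP[r /= r0 Sr]]].
  move=> /nbhs_normP[s /= s0 Ts] STK.
  exists (Num.min r s), K; split; [by rewrite lt_min r0|exact: ltW|].
  move=> x y Dx Dy; rewrite !lt_min => /andP[xr _] /andP[_ ys].
  by apply: (STK (x, y)) => //; split => /=; [apply: Sr|apply: Ts];
    rewrite /ball_ /= distrC.
have within_prod : ProperFilter (within (D `*` D) (nbhs (x0, y0))).
  by apply: within_nbhs_proper; apply: subset_closure.
apply/ex_dom_bound.
have [<-|xy0] := eqVneq x0 y0.
  have [r [K [r0 K0 FK]]] := F_lip _ Dx0.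
  exists K; rewrite /dominated_by /within /=.
  exists (ball x0 r, ball x0 r) => /=.
    by split; apply: nbhsx_ballx.
  move=> [x y] [] /=; rewrite -!ball_normE /ball_ /= => xr yr [/= Dx Dy].
  by apply: FK => //; rewrite distrC.
have [r [M [r0 M0 FM]]] := lipschitz_at_bounded Dx0 (F_lip _ Dx0).
have [s [N [s0 N0 FN]]] := lipschitz_at_bounded Dy0 (F_lip _ Dy0).
(* If x and y stay within e of x0 and y0, their distance is at least 2 * e. *)
pose e := `|x0 - y0| / 4.
have e0 : 0 < e by rewrite divr_gt0// normr_gt0 subr_eq0.
exists ((M + N) / e); rewrite /dominated_by /within /=.
exists (ball x0 (Num.min e r), ball y0 (Num.min e s)) => /=.
  by split; apply: nbhsx_ballx; rewrite lt_min e0.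
move=> [x y] [] /=; rewrite -!ball_normE /ball_ /= !lt_min.
move=> /andP[xe xr] /andP[ye ys] [/= Dx Dy].
rewrite (le_trans (ler_normB _ _))//.
rewrite (@le_trans _ _ (M + N))//.
  by rewrite lerD// ?FM ?FN// distrC.
rewrite -mulrA ler_peMr ?addr_ge0// ler_pdivlMl// mulr1.
have /= := ler_distD x x0 y0; have := ler_distD y x y0.
rewrite (distrC y y0); move: xe ye e0; rewrite /e; lra.
Qed.

Lemma lipschitz_at_setT V W (D : set V) (F : V -> W) x0 :
  lipschitz F -> lipschitz_at D F x0.
Proof.
move=> /pinfty_ex_gt0[K K0 FK]; exists 1, K; split => //; first exact: ltW.
by move=> x y _ _ _ _; apply: (FK (x, y)).
Qed.

Lemma lipschitz_at_cvg V W (D : set V) (F : V -> W) x0 e :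
  D x0 -> lipschitz_at D F x0 -> 0 < e ->
  exists2 r, 0 < r & forall x, D x -> `|x - x0| < r -> `|F x - F x0| < e.
Proof.
move=> Dx0 [r [K [r0 K0 FK]]] e0.
exists (Num.min r (e / (K + 1))); first by rewrite lt_min r0 divr_gt0// ltr_wpDl.
move=> x Dx; rewrite lt_min => /andP[xr]; rewrite ltr_pdivlMr ?ltr_wpDl// => xe.
rewrite (le_lt_trans (FK _ _ _ _ _ _))// ?subrr ?normr0//.
rewrite mulrC (le_lt_trans _ xe)// ler_wpM2l//. lra.
Qed.

Lemma lipschitz_atD V W (D : set V) (F G : V -> W) x0 :
  lipschitz_at D F x0 -> lipschitz_at D G x0 ->
  lipschitz_at D (fun x => F x + G x) x0.
Proof.
move=> [r [K [r0 K0 FK]]] [s [L [s0 L0 GL]]].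
exists (Num.min r s), (K + L).
split => [||x y Dx Dy]; [by rewrite lt_min r0|exact: addr_ge0|].
rewrite !lt_min => /andP[xr xs] /andP[yr ys].
rewrite opprD addrACA mulrDl (le_trans (ler_normD _ _))//.
by rewrite lerD ?FK ?GL.
Qed.

Lemma lipschitz_at_comp V V' W (D : set V) (E : set V') (F : V -> V')
    (G : V' -> W) x0 :
  D x0 -> (forall x, D x -> E (F x)) ->
  lipschitz_at D F x0 -> lipschitz_at E G (F x0) ->
  lipschitz_at D (G \o F) x0.
Proof.
move=> Dx0 DE F_lip [s [L [s0 L0 GL]]].
have [t t0 Ft] := lipschitz_at_cvg Dx0 F_lip s0.
have [r [K [r0 K0 FK]]] := F_lip.
exists (Num.min r t), (L * K).
split => [||x y Dx Dy]; [by rewrite lt_min r0|exact: mulr_ge0|].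
rewrite !lt_min => /andP[xr xt] /andP[yr yt].
rewrite -mulrA (le_trans (GL _ _ _ _ _ _))//; [exact: DE|exact: DE|exact: Ft|exact: Ft|].
by rewrite ler_wpM2l// FK.
Qed.

Lemma lipschitz_at_mulmx V (D : set V) p q s (F : V -> 'M[R]_(p, q))
    (G : V -> 'M[R]_(q, s)) x0 :
  D x0 -> lipschitz_at D F x0 -> lipschitz_at D G x0 ->
  lipschitz_at D (fun x => F x *m G x) x0.
Proof.
move=> Dx0 F_lip G_lip.
have [r' [M [r'0 M0 FM]]] := lipschitz_at_bounded Dx0 F_lip.
have [s' [N [s'0 N0 GN]]] := lipschitz_at_bounded Dx0 G_lip.
move: F_lip G_lip => [r [K [r0 K0 FK]]] [t [L [t0 L0 GL]]].
exists (Num.min (Num.min r t) (Num.min r' s')), (q%:R * (M * L + K * N)).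
split => [||x y Dx Dy]; first by rewrite !lt_min r0 t0 r'0.
  by rewrite mulr_ge0// addr_ge0// mulr_ge0.
rewrite !lt_min => /andP[/andP[xr xt] /andP[xr' xs']].
move=> /andP[/andP[yr yt] /andP[yr' ys']].
have -> : F x *m G x - F y *m G y = F x *m (G x - G y) + (F x - F y) *m G y.
  by rewrite mulmxBr mulmxBl addrA subrK.
rewrite (le_trans (ler_normD _ _))// -mulrA mulrDl mulrDr lerD//.
  rewrite (le_trans (ler_norm_mulmx _ _))// -!mulrA ler_wpM2l// ler_pM//.
    exact: FM.
  exact: GL.
rewrite (le_trans (ler_norm_mulmx _ _))// -!mulrA ler_wpM2l//.
by rewrite (mulrC N) mulrA ler_pM// ?FK ?GN.
Qed.

Lemma lipschitz_at_entry V (D : set V) p q (F : V -> 'M[R]_(p, q)) i j x0 :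
  lipschitz_at D F x0 -> lipschitz_at D (fun x => F x i j) x0.
Proof.
move=> [r [K [r0 K0 FK]]]; exists r, K; split => // x y Dx Dy xr yr.
apply: le_trans (FK _ _ Dx Dy xr yr).
by have := ler_entry_norm (F x - F y) i j; rewrite !mxE.
Qed.

Lemma lipschitz_at_cst (V W : normedModType R) (D : set V) (c : W) x0 :
  lipschitz_at D (fun=> c) x0.
Proof.
by exists 1, 0; split => // x y _ _ _ _; rewrite subrr normr0 mul0r.
Qed.

Lemma lipschitz_at_id (V : normedModType R) (D : set V) x0 : lipschitz_at D id x0.
Proof. by exists 1, 1; split => // x y _ _ _ _; rewrite mul1r. Qed.

Lemma lipschitz_at_trmx p q (D : set 'M[R]_(p, q)) x0 : lipschitz_at D trmx x0.
Proof.
by exists 1, 1; split => // x y _ _ _ _; rewrite mul1r -linearB /= norm_trmx.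
Qed.

Lemma lipschitz_at_continuous (V W : normedModType R) (F : V -> W) x0 :
  lipschitz_at setT F x0 -> {for x0, continuous F}.
Proof.
move=> F_lip; apply/cvgrPdist_lt => e e0; apply/nbhs_normP.
have [r r0 Fr] := lipschitz_at_cvg I F_lip e0.
by exists r => //= x xr; rewrite distrC Fr// distrC.
Qed.

(** Row vectors have this property already; transposition is an isometry. *)
Lemma bounded_closed_compact_cV m (K : set 'cV[R]_m) :
  bounded_set K -> closed K -> compact K.
Proof.
move=> [M [Mreal KM]] closedK.
have trmx_cont p q : continuous (@trmx R p q).
  by move=> x; apply: lipschitz_at_continuous; exact: lipschitz_at_trmx.
have -> : K = trmx @` (trmx @^-1` K).
  apply/seteqP; split=> [v Kv|_ [v Kv <-]//].
  by exists v^T; rewrite /= trmxK.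
apply: continuous_compact; first exact/continuous_subspaceT/trmx_cont.
apply: bounded_closed_compact; last exact: (preimage_closed (fun v _ => trmx_cont _ _ v)).
by exists M; split=> // N MN v Kv; rewrite /= -norm_trmx KM.
Qed.

End LocalLipschitz.

(** * Continuously differentiable functions *)

Section ContinuouslyDifferentiable.
Context {R : realType} {n : nat}.
Implicit Types (B : 'cV[R]_n -> R) (x v : 'cV[R]_n).

Lemma derive_gradE B x v : differentiable B x ->
  'D_v B x = (grad B x *m v) 0 0.
Proof.
move=> dB; rewrite deriveE// {1}[v]matrix_sum_delta linear_sum mxE.
apply: eq_bigr => i _; rewrite big_ord1 linearZ /= mxE deriveE//.
by rewrite mulrC.
Qed.

Lemma is_derive_line B y v (t : R) : differentiable B (y + t *: v) ->
  is_derive t 1 (fun s : R => B (y + s *: v)) ('D_v B (y + t *: v)).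
Proof.
move=> dB; have BD : derivable B (y + t *: v) v by apply: diff_derivable.
pose F s := B (y + s *: v).
have quotientE :
    (fun h : R => h^-1 *: ((F \o shift t) (h *: 1) - F t)) =
    (fun h : R => h^-1 *: ((B \o shift (y + t *: v)) (h *: v) - B (y + t *: v))).
  by apply/funext => h; rewrite /F /= [h *: 1]mulr1 scalerDl addrCA.
by rewrite -/F; split; [rewrite /derivable quotientE|rewrite /derive quotientE].
Qed.

(** The mean value theorem on segments of a ball, which is convex, where the
    gradient is bounded by continuity. *)
Lemma continuously_differentiable_lipschitz_at B (D : set 'cV[R]_n) x0 :
  continuously_differentiable B -> lipschitz_at D B x0.
Proof.
move=> [dB cB]; have /cvgrPdist_lt/(_ _ ltr01)/nbhs_normP[r /= r0 gradB] := cB x0.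
have gradB_le z : `|z - x0| < r -> `|grad B z| <= `|grad B x0| + 1.
  move=> zr; rewrite -[grad B z](subrK (grad B x0)) addrC.
  rewrite (le_trans (ler_normD _ _))// lerD2l ltW// distrC gradB//.
  by rewrite /ball_ /= distrC.
exists r, (n%:R * (`|grad B x0| + 1)); split => // x y _ _ xr yr.
have [t _||t] := @MVT_segment R (fun s => B (y + s *: (x - y)))
  (fun s => 'D_(x - y) B (y + s *: (x - y))) 0 1 ler01.
- exact: is_derive_line.
- apply: derivable_within_continuous => s _.
  by have /@ex_derive := is_derive_line (dB (y + s *: (x - y))).
rewrite in_itv /= scale1r scale0r addr0 subrKC subr0 mulr1 => /andP[t0 t1] ->.
rewrite derive_gradE// (le_trans (ler_entry_norm _ _ _))//.
rewrite (le_trans (ler_norm_mulmx _ _))// ler_wpM2r// ler_wpM2l// gradB_le//.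
have -> : y + t *: (x - y) - x0 = (1 - t) *: (y - x0) + t *: (x - x0).
  rewrite !scalerBl !scalerBr scale1r; apply/matrixP => i j; rewrite !mxE; ring.
rewrite (le_lt_trans (ler_normD _ _))// !normrZ !ger0_norm ?subr_ge0//.
have [->|t0'] := eqVneq t 0; first by rewrite mul0r addr0 subr0 mul1r.
have -> : r = (1 - t) * r + t * r by rewrite -mulrDl subrK mul1r.
apply: ler_ltD; first by rewrite ler_wpM2l ?subr_ge0// ltW.
by rewrite ltr_pM2l// lt0r t0'.
Qed.

End ContinuouslyDifferentiable.

(** * Nearest points in a convex set cut by a half-space *)

Section NearestPoint.
Context {R : realType} {m : nat}.
Implicit Types (r a : 'rV[R]_m) (u v w z : 'cV[R]_m) (h mu : R).
Implicit Types (P U : set 'cV[R]_m).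

Definition dot r v : R := (r *m v) 0 0.

Lemma dotDl r a v : dot (r + a) v = dot r v + dot a v.
Proof. by rewrite /dot mulmxDl mxE. Qed.

Lemma dotBl r a v : dot (r - a) v = dot r v - dot a v.
Proof. by rewrite /dot mulmxBl !mxE. Qed.

Lemma dotDr r u v : dot r (u + v) = dot r u + dot r v.
Proof. by rewrite /dot mulmxDr mxE. Qed.

Lemma dotBr r u v : dot r (u - v) = dot r u - dot r v.
Proof. by rewrite /dot mulmxBr !mxE. Qed.

Lemma dotZr r t v : dot r (t *: v) = t * dot r v.
Proof. by rewrite /dot -scalemxAr mxE. Qed.

Lemma dotC u v : dot u^T v = dot v^T u.
Proof. by rewrite /dot -[v in LHS]trmxK -trmx_mul mxE. Qed.

Lemma dotZl t r v : dot (t *: r) v = t * dot r v.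
Proof. by rewrite /dot -scalemxAl mxE. Qed.

Definition dotE := (dotBl, dotBr, dotDl, dotDr, dotZl, dotZr).

Lemma ler_norm_dot r v : `|dot r v| <= m%:R * `|r| * `|v|.
Proof. exact: le_trans (ler_entry_norm _ _ _) (ler_norm_mulmx _ _). Qed.

Lemma dot_sqr v : dot v^T v = \sum_i v i 0 ^+ 2.
Proof. by rewrite /dot mxE; apply: eq_bigr => i _; rewrite mxE expr2. Qed.

Lemma dot_sqr_ge0 v : 0 <= dot v^T v.
Proof. by rewrite dot_sqr sumr_ge0// => i _; exact: sqr_ge0. Qed.

Lemma dot_sqrD u v t : dot (u + t *: v)^T (u + t *: v) =
  dot u^T u + 2 * t * dot u^T v + t ^+ 2 * dot v^T v.
Proof.
rewrite linearD linearZ /= !dotE (dotC v u); ring.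
Qed.

(** The norm of a vector is the maximum norm, whereas distances to be minimised are
    Euclidean; this and [ler_norm_dot] compare the two. *)
Lemma sqr_norm_le_dot v : `|v| ^+ 2 <= dot v^T v.
Proof.
rewrite -[leRHS]sqr_sqrtr ?dot_sqr_ge0// ler_sqr ?nnegrE ?sqrtr_ge0//.
apply: norm_mx_le => [|i j]; first exact: sqrtr_ge0.
rewrite (ord1 j) -sqrtr_sqr ler_wsqrtr// dot_sqr (bigD1 i)//= lerDl.
by rewrite sumr_ge0// => k _; exact: sqr_ge0.
Qed.

Definition convex P := forall u v t,
  P u -> P v -> 0 <= t <= 1 -> P (u + t *: (v - u)).

Definition nearest_point P z u := P u /\
  forall v, P v -> dot (u - z)^T (u - z) <= dot (v - z)^T (v - z).

Definition halfspace_cut U a h : set 'cV[R]_m :=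
  U `&` [set v | 0 <= dot a v + h].

Lemma convex_halfspace_cut U a h : convex U -> convex (halfspace_cut U a h).
Proof.
move=> cU u v t [Uu au] [Uv av] t01; split; first exact: cU.
move: au av; rewrite /= !dotE => au av; case/andP: t01 => t0 t1.
have -> : dot a u + t * (dot a v - dot a u) + h =
    (1 - t) * (dot a u + h) + t * (dot a v + h) by ring.
by rewrite addr_ge0// mulr_ge0// subr_ge0.
Qed.

(** Along the segment from [u] to [v] the squared distance to [z] is a quadratic
    in [t] with slope [2 * <u - z, v - u>] at [t = 0]. *)
Lemma nearest_point_variational P z u v : convex P -> nearest_point P z u ->
  P v -> 0 <= dot (u - z)^T (v - u).
Proof.
move=> cP [Pu umin] Pv; rewrite leNgt; apply/negP.
set c := dot _ _ => c0; pose q := dot (v - u)^T (v - u).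
have q0 : 0 <= q by exact: dot_sqr_ge0.
have key t : 0 <= t <= 1 -> 0 <= 2 * t * c + t ^+ 2 * q.
  move=> t01; have := umin _ (cP _ _ _ Pu Pv t01); rewrite addrAC.
  have -> : dot (u - z + t *: (v - u))^T (u - z + t *: (v - u)) =
      dot (u - z)^T (u - z) + (2 * t * c + t ^+ 2 * q).
    by rewrite dot_sqrD -/c -/q; ring.
  by rewrite lerDl.
(* For this t the linear term 2 * t * c outweighs t ^ 2 * q. *)
pose t := Num.min 1 (- c / (q + 1)).
have t0 : 0 < t by rewrite lt_min ltr01 divr_gt0 ?oppr_gt0// ltr_wpDl.
have tq : t * (q + 1) <= - c by rewrite -ler_pdivlMr ?ltr_wpDl// ge_min lexx orbT.
have : 0 <= t * (2 * c + t * q).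
  have -> : t * (2 * c + t * q) = 2 * t * c + t ^+ 2 * q by ring.
  by rewrite key// ltW//= ge_min lexx.
rewrite pmulr_rge0//; nra.
Qed.

(** First-order optimality conditions with a multiplier for the half-space only:
    [u] is the nearest point of [U] to [z] shifted by [mu] times the normal [a]. *)
Definition kkt U a h z u mu :=
  [/\ halfspace_cut U a h u, 0 <= mu, mu * (dot a u + h) = 0 &
      forall v, U v -> mu * dot a (v - u) <= dot (u - z)^T (v - u)].

(** On [U] the variational inequality says [phi >= 0] wherever [psi >= 0], for
    the affine functions [phi v = <u - z, v - u>] and [psi v = a (v - u)] (when
    the half-space is active).  The multiplier is the least slope [phi / psi] over
    the points with [psi > 0], of which the strictly feasible point is one.  The
    slope at a point with [psi < 0] cannot exceed any of these, since [phi >= 0]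
    where the segment joining the two points meets [psi = 0]. *)
Lemma kkt_exists U a h z u ubar : convex U -> U ubar -> 0 < dot a ubar + h ->
  nearest_point (halfspace_cut U a h) z u -> exists mu, kkt U a h z u mu.
Proof.
move=> cU Uubar slater u_near; have [[Uu au] _] := u_near.
pose phi v := dot (u - z)^T (v - u); pose psi v := dot a (v - u).
have phiP v : U v -> 0 <= dot a v + h -> 0 <= phi v.
  move=> Uv av; apply: nearest_point_variational u_near (conj Uv av).
  exact: convex_halfspace_cut.
have affine f v w t : dot f (v + t *: (w - v) - u) =
    dot f (v - u) + t * (dot f (w - u) - dot f (v - u)) by rewrite !dotE; ring.
have ray f v t : dot f (u + t *: (v - u) - u) = t * dot f (v - u).
  by rewrite addrAC subrr add0r dotZr.
have psi_cut v : dot a v + h = (dot a u + h) + psi v by rewrite /psi dotBr; ring.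
have [au0|] := ltP 0 (dot a u + h).
  exists 0; split; rewrite ?mul0r// => v Uv; rewrite mul0r -/(phi v).
  pose t := Num.min 1 ((dot a u + h) / (`|psi v| + 1)).
  have psi1 : 0 < `|psi v| + 1 by rewrite ltr_wpDl.
  have t0 : 0 < t by rewrite lt_min ltr01 divr_gt0.
  have : 0 <= phi (u + t *: (v - u)).
    apply: phiP; first by apply: cU => //; rewrite ltW//= ge_min lexx.
    have : t * (`|psi v| + 1) <= dot a u + h.
      by rewrite -ler_pdivlMr// ge_min lexx orbT.
    rewrite [dot a (u + _) + h]psi_cut {2}/psi ray -/(psi v).
    have := ler_norm (- psi v); rewrite normrN; nra.
  by rewrite /phi ray pmulr_rge0.
move=> au_le0; have au0 : dot a u + h = 0 by apply/le_anti; rewrite au_le0.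
have {}psi_cut v : dot a v + h = psi v by rewrite psi_cut au0 add0r.
have {}phiP v : U v -> 0 <= psi v -> 0 <= phi v by rewrite -psi_cut; exact: phiP.
pose E := [set phi v / psi v | v in U `&` [set v | 0 < psi v]].
have E0 : E !=set0.
  by exists (phi ubar / psi ubar), ubar => //; split => //=; rewrite -psi_cut.
have E_ge0 : lbound E 0.
  by move=> _ [v [Uv /= /ltW v0] <-]; apply: divr_ge0; first exact: phiP.
exists (inf E); split; [by []|exact: lb_le_inf|by rewrite au0 mulr0|].
move=> v Uv; rewrite -/(psi v) -/(phi v).
have [v0|v0|v0] := ltgtP (psi v) 0; last by rewrite v0 mulr0 phiP// v0.
  rewrite -ler_ndivrMr// lb_le_inf// => _ [w [Uw /= w0] <-].
  rewrite ler_ndivrMr// mulrAC ler_pdivrMr//.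
  (* The point of the segment from v to w at which psi vanishes. *)
  pose t := - psi v / (psi w - psi v).
  have vw0 : 0 < psi w - psi v by rewrite subr_gt0 (lt_trans v0).
  have tE : t * (psi w - psi v) = - psi v by rewrite mulfVK// gt_eqF.
  have t01 : 0 <= t <= 1.
    apply/andP; split; last by rewrite ler_pdivrMr// mul1r lerDr ltW.
    by apply: divr_ge0; [rewrite oppr_ge0 ltW|exact: ltW].
  have := phiP _ (cU _ _ _ Uv Uw t01).
  rewrite /psi affine -/(psi v) -/(psi w) tE subrr => /(_ (lexx 0)).
  rewrite /phi affine -/(phi v) -/(phi w) => phi_ge0.
  have : 0 <= (phi v + t * (phi w - phi v)) * (psi w - psi v).
    by rewrite mulr_ge0// ltW.
  rewrite mulrDl mulrAC tE; lra.
rewrite -ler_pdivlMr//; apply: ge_inf; first by exists 0.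
by exists v.
Qed.

(** Test each variational inequality at the other solution and add them;
    complementarity and feasibility eliminate the half-space terms.  The result is
    arranged so that the multipliers enter through their difference, times a
    perturbation of the data, or else next to [u1 - u2]: both are needed for a
    Lipschitz bound. *)
Lemma kkt_monotone U a1 a2 h1 h2 z1 z2 u1 u2 mu1 mu2 :
  kkt U a1 h1 z1 u1 mu1 -> kkt U a2 h2 z2 u2 mu2 ->
  dot (u1 - u2)^T (u1 - u2) <= dot (u1 - u2)^T (z1 - z2) +
    (mu1 - mu2) * ((h2 - h1) + dot (a2 - a1) u2) + mu2 * dot (a1 - a2) (u1 - u2).
Proof.
move=> [[U1 c1] mu1_ge0 s1 v1] [[U2 c2] mu2_ge0 s2 v2].
have := v1 _ U2; have := v2 _ U1.
move: (mulr_ge0 mu1_ge0 c2) (mulr_ge0 mu2_ge0 c1) s1 s2.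
rewrite /= [dot (u1 - u2)^T (z1 - z2)]dotC !linearB /= !dotE.
rewrite (dotC u2 u1) => *; lra.
Qed.

End NearestPoint.

(** * Stability estimates *)

Section Estimates.
Context {R : realType} {m : nat}.
Implicit Types (a : 'rV[R]_m) (u w z : 'cV[R]_m) (h mu delta L M : R).
Implicit Types (U : set 'cV[R]_m).

(** [kkt_monotone] with all perturbations of the data measured by [delta]. *)
Lemma kkt_distance U a1 a2 h1 h2 z1 z2 u1 u2 mu1 mu2 L M delta :
  kkt U a1 h1 z1 u1 mu1 -> kkt U a2 h2 z2 u2 mu2 ->
  0 <= L -> 0 <= delta -> `|u2| <= M -> mu2 <= M ->
  `|a1 - a2| <= L * delta -> `|h1 - h2| <= L * delta ->
  `|z1 - z2| <= L * delta ->
  `|u1 - u2| ^+ 2 <=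
    L * (1 + m%:R) * (1 + M) * delta * (`|u1 - u2| + `|mu1 - mu2|).
Proof.
move=> k1 k2 L0 d0 uM muM aL hL zL.
have [_ mu2_ge0 _ _] := k2.
have M0 : 0 <= M by exact: le_trans muM.
set s := `|u1 - u2|; set D := `|mu1 - mu2|; set e := L * delta.
have e0 : 0 <= e by rewrite mulr_ge0.
have s0 : 0 <= s by exact: normr_ge0.
have D0 : 0 <= D by exact: normr_ge0.
have m0 : 0 <= m%:R :> R by [].
have T1 : dot (u1 - u2)^T (z1 - z2) <= m%:R * s * e.
  rewrite (le_trans (ler_norm _))// (le_trans (ler_norm_dot _ _))// norm_trmx.
  by rewrite ler_wpM2l// mulr_ge0.
have T2 : (mu1 - mu2) * ((h2 - h1) + dot (a2 - a1) u2) <= D * (e + m%:R * e * M).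
  rewrite (le_trans (ler_norm _))// normrM ler_wpM2l//.
  rewrite (le_trans (ler_normD _ _))// lerD ?(distrC h2)//.
  rewrite (le_trans (ler_norm_dot _ _))// ler_pM ?mulr_ge0//.
  by rewrite ler_wpM2l// distrC.
have T3 : mu2 * dot (a1 - a2) (u1 - u2) <= M * (m%:R * e * s).
  rewrite (le_trans (ler_norm _))// normrM (ger0_norm mu2_ge0) ler_pM//.
  by rewrite (le_trans (ler_norm_dot _ _))// ler_wpM2r// ler_wpM2l.
have := le_trans (sqr_norm_le_dot _) (kkt_monotone k1 k2); rewrite -/s => H.
have {H T1 T2 T3} := le_trans H (lerD (lerD T1 T2) T3) => /le_trans; apply.
have -> : L * (1 + m%:R) * (1 + M) * delta * (s + D) =
   m%:R * s * e + D * (e + m%:R * e * M) + M * (m%:R * e * s) +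
   (e * s + e * s * M + e * D * m%:R + e * D * M).
  by rewrite /e; ring.
by rewrite lerDl !addr_ge0// !mulr_ge0.
Qed.

(** In a direction [w] along which optimality is an equality, the multiplier is a
    quotient of inner products of the data and the solution; its denominator is kept
    away from 0 by the lower bound [2^-1]. *)
Lemma multiplier_distance a1 a2 z1 z2 u1 u2 w mu1 mu2 L M delta :
  0 <= mu2 -> 0 <= L -> 0 <= delta -> mu2 <= M ->
  `|a1 - a2| <= L * delta -> `|z1 - z2| <= L * delta ->
  2^-1 <= dot a1 w ->
  mu1 * dot a1 w = dot (u1 - z1)^T w -> mu2 * dot a2 w = dot (u2 - z2)^T w ->
  `|mu1 - mu2| <=
    2 * m%:R * `|w| * (1 + L * (1 + M)) * (`|u1 - u2| + delta).
Proof.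
move=> mu2_ge0 L0 d0 muM aL zL aw E1 E2.
have M0 : 0 <= M by exact: le_trans muM.
have E : (mu1 - mu2) * dot a1 w =
    dot (u1 - u2)^T w - dot (z1 - z2)^T w - mu2 * dot (a1 - a2) w.
  have -> : (mu1 - mu2) * dot a1 w =
    (mu1 * dot a1 w - mu2 * dot a2 w) - mu2 * (dot a1 w - dot a2 w) by ring.
  rewrite E1 E2 !linearB /= !dotE; ring.
set s := `|u1 - u2|; set e := L * delta; set W := `|w|.
have dot_le (b : 'rV[R]_m) t : `|b| <= t -> `|dot b w| <= m%:R * t * W.
  by move=> bt; rewrite (le_trans (ler_norm_dot _ _))// ler_wpM2r// ler_wpM2l.
have : `|mu1 - mu2| * 2^-1 <= m%:R * s * W + m%:R * e * W + M * (m%:R * e * W).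
  apply: le_trans (_ : `|(mu1 - mu2) * dot a1 w| <= _).
    by rewrite normrM ler_wpM2l// (le_trans aw)// ler_norm.
  rewrite E (le_trans (ler_normB _ _))// lerD//.
    by rewrite (le_trans (ler_normB _ _))// lerD// dot_le ?norm_trmx.
  by rewrite normrM (ger0_norm mu2_ge0) ler_pM// dot_le.
rewrite ler_pdivrMr// => /le_trans; apply.
have -> : 2 * m%:R * W * (1 + L * (1 + M)) * (s + delta) =
  (m%:R * s * W + m%:R * e * W + M * (m%:R * e * W)) * 2 +
  2 * m%:R * W * (delta + L * (1 + M) * s).
  by rewrite /e; ring.
by rewrite lerDl mulr_ge0 ?addr_ge0 ?mulr_ge0 ?addr_ge0 ?normr_ge0.
Qed.

Lemma sqr_le_self_bound (s delta K : R) : 0 <= s -> 0 <= delta -> 0 <= K ->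
  s ^+ 2 <= K * delta * (s + delta) -> s <= (K + 1) * delta.
Proof.
move=> s0 d0 K0 sK; rewrite leNgt; apply/negP => lt_s.
have dK : 0 <= (K + 1) * delta by rewrite mulr_ge0// addr_ge0.
have s_gt0 := le_lt_trans dK lt_s.
have : (K + 1) * delta * s < s ^+ 2 by rewrite expr2 ltr_pM2r.
have : 0 <= (s - (K + 1) * delta) * delta by rewrite mulr_ge0// subr_ge0 ltW.
have : 0 <= K * delta ^+ 2 by rewrite mulr_ge0// sqr_ge0.
have := sqr_ge0 delta; nra.
Qed.
End Estimates.

(** * Dual vectors and polyhedra *)

(** The coordinate forms of a free family are linear, hence given by column
    vectors. *)
Lemma free_dual_vector (K : fieldType) m (T : finType) (S : {set T})
    (F : T -> 'rV[K]_m) k0 :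
  free [seq F k | k in S] -> k0 \in S ->
  exists w : 'cV[K]_m, (F k0 *m w) 0 0 = 1 /\
    forall k, k \in S -> k != k0 -> (F k *m w) 0 0 = 0.
Proof.
move=> freeF k0S; pose X := in_tuple [seq F k | k in S].
have sizeX : size [seq F k | k in S] = size (enum S) by rewrite size_map.
have idx k : k \in S -> (index k (enum S) < size [seq F k | k in S])%N.
  by move=> kS; rewrite sizeX index_mem mem_enum.
pose w : 'cV[K]_m := \col_j coord X (Ordinal (idx _ k0S)) 'e_j.
have wE v : (v *m w) 0 0 = coord X (Ordinal (idx _ k0S)) v.
  rewrite {2}[v]row_sum_delta linear_sum mxE.
  by apply: eq_bigr => j _; rewrite linearZ mxE.
have XE k (kS : k \in S) : F k = X`_(Ordinal (idx _ kS)).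
  by rewrite /= (nth_map k) ?index_mem ?mem_enum// nth_index// mem_enum.
exists w; split=> [|k kS kk0]; rewrite wE (XE _ ltac:(eassumption)) coord_free//.
  by rewrite eqxx.
rewrite -val_eqE /=; case: eqP => // eqi.
case/eqP: kk0; rewrite -[k](nth_index k0 (s := enum S)) ?mem_enum// eqi.
by rewrite nth_index// mem_enum.
Qed.

Section Polyhedron.
Context {R : realType} {m p : nat}.
Variables (A : 'M[R]_(p, m)) (b : 'cV[R]_p).
Implicit Types (u v w z : 'cV[R]_m).

Lemma convex_input_set : convex (input_set A b).
Proof.
move=> u v t Uu Uv /andP[t0 t1] i.
have -> : (A *m (u + t *: (v - u)) + b) i 0 =
    (1 - t) * (A *m u + b) i 0 + t * (A *m v + b) i 0.
  by rewrite mulmxDr -scalemxAr mulmxBr !mxE; ring.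
by rewrite -[leRHS]addr0 lerD// mulr_ge0_le0// subr_ge0.
Qed.

(** Along [w] the active constraints do not change; the inactive ones have a
    positive slack at [u0], which absorbs small changes both of the point and of the
    step.  The step is uniform over the points [u] close to [u0]. *)
Lemma active_direction_feasible u0 w :
  (forall i, (A *m u0 + b) i 0 = 0 -> (A *m w) i 0 = 0) -> input_set A b u0 ->
  exists2 e, 0 < e & forall u s, input_set A b u -> `|u - u0| <= e -> `|s| <= e ->
    input_set A b (u + s *: w).
Proof.
move=> Aw Uu0; pose c := m%:R * `|A| * (1 + `|w|).
have c0 : 0 <= c by rewrite !mulr_ge0// addr_ge0.
have [e e0 eP] : exists2 e : R, 0 < e & forall i, (A *m u0 + b) i 0 != 0 ->
    (A *m u0 + b) i 0 + c * e <= 0.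
  pose e := \big[Num.min/1]_(i | (A *m u0 + b) i 0 != 0)
    (- (A *m u0 + b) i 0 / (c + 1)).
  exists e.
    apply: lt_bigmin => // i i0; rewrite divr_gt0 ?ltr_wpDl// oppr_gt0 lt_neqAle i0.
    exact: Uu0.
  move=> i i0; have : e <= - (A *m u0 + b) i 0 / (c + 1) by exact: bigmin_le_cond.
  have e0 : 0 <= e.
    apply: le_bigmin => // j j0; rewrite divr_ge0 ?addr_ge0// oppr_ge0.
    exact: Uu0.
  rewrite ler_pdivlMr ?ltr_wpDl//; nra.
exists e => // u s Uu ue se i; rewrite mulmxDr -scalemxAr.
have [i0|i0] := eqVneq ((A *m u0 + b) i 0) 0.
  by have := Uu i; have := Aw i i0; rewrite !mxE => ->; rewrite mulr0 addr0.
apply: le_trans (eP i i0).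
have -> : (A *m u + s *: (A *m w) + b) i 0 =
    (A *m u0 + b) i 0 + (A *m (u - u0 + s *: w)) i 0.
  by rewrite mulmxDr mulmxBr -scalemxAr !mxE; ring.
rewrite lerD2l (le_trans (ler_norm _))// (le_trans (ler_entry_norm _ _ _))//.
rewrite (le_trans (ler_norm_mulmx _ _))// -[leRHS]mulrA ler_wpM2l ?mulr_ge0//.
rewrite (le_trans (ler_normD _ _))// normrZ mulrDl mul1r lerD//.
by rewrite mulrC ler_wpM2l.
Qed.

(** The points that are not farther from [z] than a given feasible one form a
    compact set. *)
Lemma nearest_point_exists a h z : halfspace_cut (input_set A b) a h !=set0 ->
  exists u, nearest_point (halfspace_cut (input_set A b) a h) z u.
Proof.
set P := halfspace_cut _ _ _ => -[u0 Pu0].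
have entry_cont q (M : 'M[R]_(q, m)) (e : 'cV[R]_q) i :
    continuous (fun v : 'cV[R]_m => (M *m v + e) i 0).
  move=> v; apply: (@lipschitz_at_continuous R _ _ (fun v => (M *m v + e) i 0)).
  apply: lipschitz_at_entry; apply: lipschitz_atD; last exact: lipschitz_at_cst.
  by apply: lipschitz_at_mulmx => //; [exact: lipschitz_at_cst|exact: lipschitz_at_id].
have closedP : closed P.
  apply: closedI.
    have -> : input_set A b = \bigcap_(i in setT) [set v | (A *m v + b) i 0 <= 0].
      by apply/seteqP; split=> v Uv i => [_|]; exact: Uv.
    apply: closed_bigI => i _.
    exact: (preimage_closed (fun v _ => @entry_cont _ _ _ i v) (@closed_le _ 0)).
  have -> : [set v | 0 <= dot a v + h] = [set v | 0 <= (a *m v + h%:M) 0 0].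
    by apply/seteqP; split=> v; rewrite /= mxE [h%:M 0 0]mxE eqxx mulr1n.
  exact: (preimage_closed (fun v _ => @entry_cont _ _ _ 0 v) (@closed_ge _ 0)).
have dist_cont : continuous (fun v => dot (v - z)^T (v - z)).
  move=> v; apply: (@lipschitz_at_continuous R _ _ (fun v => dot (v - z)^T (v - z))).
  have sub_lip : lipschitz_at setT (fun w => w - z) v.
    by apply: lipschitz_atD; [exact: lipschitz_at_id|exact: lipschitz_at_cst].
  apply: (@lipschitz_at_entry R _ _ _ _ (fun v => (v - z)^T *m (v - z))).
  apply: lipschitz_at_mulmx => //.
  exact: (@lipschitz_at_comp _ _ _ _ _ setT _ trmx _ _ _ sub_lip (lipschitz_at_trmx _ _)).
pose c := dot (u0 - z)^T (u0 - z).
pose Q := P `&` [set v | dot (v - z)^T (v - z) <= c].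
have compactQ : compact Q.
  apply: bounded_closed_compact_cV.
    exists (`|z| + Num.sqrt c); split; first exact: num_real.
    move=> M zM v [_ /= vc]; rewrite (le_trans _ (ltW zM))//.
    rewrite -[v](subrK z) addrC (le_trans (ler_normD _ _))// lerD2l.
    rewrite -[leLHS]ger0_norm// -sqrtr_sqr ler_wsqrtr//.
    exact: le_trans (sqr_norm_le_dot _) vc.
  apply: closedI => //.
  exact: (preimage_closed (fun v _ => dist_cont v) (@closed_le _ c)).
have Q0 : Q !=set0 by exists u0; split => /=.
have [u /set_mem[Pu uc] umin] :=
  compact_EVT_min Q0 compactQ (continuous_subspaceT dist_cont).
exists u; split => // v Pv; have [vc|/ltW vc] := leP (dot (v - z)^T (v - z)) c.
  by apply: umin; apply/mem_set.
exact: le_trans vc.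
Qed.

End Polyhedron.

(** * Nearest points depending on a parameter *)

Section Bounds.
Context {R : realType} {m : nat}.
Implicit Types (a : 'rV[R]_m) (u v z : 'cV[R]_m) (P U : set 'cV[R]_m).

Lemma nearest_point_norm P z u v : nearest_point P z u -> P v ->
  `|u - z| <= (1 + m%:R) * `|v - z|.
Proof.
move=> [_ umin] Pv; rewrite -ler_sqr ?nnegrE ?mulr_ge0 ?addr_ge0//.
rewrite (le_trans (sqr_norm_le_dot _))// (le_trans (umin _ Pv))//.
rewrite (le_trans (ler_norm _))// (le_trans (ler_norm_dot _ _))// norm_trmx.
have -> : ((1 + m%:R) * `|v - z|) ^+ 2 = m%:R * `|v - z| * `|v - z| +
   (1 + m%:R + m%:R ^+ 2) * `|v - z| ^+ 2 by ring.
by rewrite lerDl mulr_ge0 ?addr_ge0 ?sqr_ge0.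
Qed.

(** A point at which the half-space constraint has slack [tau] bounds the
    multiplier. *)
Lemma kkt_multiplier_le U a h z u mu v tau : kkt U a h z u mu -> U v ->
  tau <= dot a v + h -> mu * tau <= m%:R * `|u - z| * `|v - u|.
Proof.
move=> [_ mu0 slack var] Uv tauv; apply: le_trans (_ : mu * dot a (v - u) <= _).
  have -> : mu * dot a (v - u) = mu * (dot a v + h) - mu * (dot a u + h).
    by rewrite dotBr; ring.
  by rewrite slack subr0 ler_wpM2l.
rewrite (le_trans (var _ Uv))// (le_trans (ler_norm _))//.
by rewrite (le_trans (ler_norm_dot _ _))// norm_trmx.
Qed.

(** Both [w] and [- w] are feasible directions, so the variational inequality is
    an equality along [w]. *)
Lemma kkt_direction U a h z u mu w e : kkt U a h z u mu -> 0 < e ->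
  U (u + e *: w) -> U (u + (- e) *: w) ->
  mu * dot a w = dot (u - z)^T w.
Proof.
move=> [_ _ _ var] e0 /var + /var; rewrite !(addrC u) !addrK !dotZr.
rewrite !(mulrCA mu) ler_pM2l// !mulNr lerN2 ler_pM2l// => le1 le2.
by apply/le_anti; rewrite le1.
Qed.

End Bounds.

Section ParametricProjection.
Context {R : realType} {V : normedModType R} {m p : nat}.
Variables (A : 'M[R]_(p, m)) (b : 'cV[R]_p) (D : set V) (x0 : V).
Variables (a : V -> 'rV[R]_m) (h : V -> R) (z u : V -> 'cV[R]_m).
Let U := input_set A b.
Let KKT x mu := kkt U (a x) (h x) (z x) (u x) mu.

Hypothesis Dx0 : D x0.
Hypothesis a_lip : lipschitz_at D a x0.
Hypothesis h_lip : lipschitz_at D h x0.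
Hypothesis z_lip : lipschitz_at D z x0.
Hypothesis u_near : forall x, D x ->
  nearest_point (halfspace_cut U (a x) (h x)) (z x) (u x).
(* When the moving half-space is active at x0, its normal is not a combination of
   the active rows of A; w certifies this. *)
Hypothesis transversal : dot (a x0) (u x0) + h x0 = 0 ->
  exists w, dot (a x0) w = 1 /\
    forall i, (A *m u x0 + b) i 0 = 0 -> (A *m w) i 0 = 0.

Lemma slater_point : exists2 v, U v & 0 < dot (a x0) v + h x0.
Proof.
have [[Uu0 /= ge0] _] := u_near Dx0.
have [lt0|] := ltP 0 (dot (a x0) (u x0) + h x0); first by exists (u x0).
move=> le0; have eq0 : dot (a x0) (u x0) + h x0 = 0 by apply/le_anti; rewrite le0.
have [w [aw Aw]] := transversal eq0.
have [e e0 eP] := active_direction_feasible Aw Uu0.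
exists (u x0 + e *: w); first by apply: eP; rewrite ?subrr ?normr0 ?gtr0_norm// ltW.
by rewrite dotDr dotZr aw mulr1 addrAC eq0 add0r.
Qed.

Lemma lipschitz_at_dot_addr v : lipschitz_at D (fun x => dot (a x) v + h x) x0.
Proof.
apply: lipschitz_atD => //.
apply: (@lipschitz_at_entry _ _ _ _ _ (fun x => a x *m v)).
by apply: lipschitz_at_mulmx => //; exact: lipschitz_at_cst.
Qed.

(** The strictly feasible point at [x0] remains feasible with half the slack nearby;
    it bounds both the nearest points and their multipliers there. *)
Lemma kkt_local : exists r L M, [/\ 0 < r, 0 <= L, 0 <= M,
    (forall x y, D x -> D y -> `|x - x0| < r -> `|y - x0| < r ->
      [/\ `|a x - a y| <= L * `|x - y|, `|h x - h y| <= L * `|x - y| &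
          `|z x - z y| <= L * `|x - y|]) &
    forall x, D x -> `|x - x0| < r ->
      [/\ `|u x| <= M, exists mu, KKT x mu & forall mu, KKT x mu -> mu <= M]].
Proof.
have [v Uv slater] := slater_point.
set tau := dot (a x0) v + h x0 in slater.
have tau2 : 0 < tau / 2 by rewrite divr_gt0.
have [r1 r1_gt0 slackP] := lipschitz_at_cvg Dx0 (lipschitz_at_dot_addr v) tau2.
have [r2 [Z [r2_gt0 Z0 zZ]]] := lipschitz_at_bounded Dx0 z_lip.
move: a_lip h_lip z_lip => [r3 [La [r3_gt0 La0 aL]]] [r4 [Lh [r4_gt0 Lh0 hL]]].
move=> [r5 [Lz [r5_gt0 Lz0 zL]]].
pose N := (1 + m%:R) * (`|v| + Z).
have N0 : 0 <= N by rewrite mulr_ge0 ?addr_ge0.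
pose M := N + Z + m%:R * N * (`|v| + (N + Z)) / (tau / 2).
have M'0 : 0 <= m%:R * N * (`|v| + (N + Z)) / (tau / 2).
  by apply: divr_ge0; [rewrite !mulr_ge0 ?addr_ge0|exact: ltW].
exists (Num.min (Num.min r1 r2) (Num.min r3 (Num.min r4 r5))), (La + Lh + Lz), M.
split; [by rewrite !lt_min r1_gt0 r2_gt0 r3_gt0 r4_gt0|by rewrite !addr_ge0|
        by rewrite !addr_ge0| |].
  move=> x y Dx Dy; rewrite !lt_min => /and3P[_ x3 /andP[x4 x5]] /and3P[_ y3 /andP[y4 y5]].
  have d0 := normr_ge0 (x - y).
  split; [apply: le_trans (aL _ _ Dx Dy x3 y3) _|apply: le_trans (hL _ _ Dx Dy x4 y4) _|
    apply: le_trans (zL _ _ Dx Dy x5 y5) _]; apply: ler_wpM2r => //; lra.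
move=> x Dx; rewrite !lt_min => /andP[/andP[x1 x2] _].
have slack : tau / 2 <= dot (a x) v + h x.
  have := slackP _ Dx x1; rewrite -/tau ltr_norml => /andP[+ _]; lra.
have vP : halfspace_cut U (a x) (h x) v by split => //=; exact: le_trans (ltW tau2) slack.
have uzN : `|u x - z x| <= N.
  rewrite (le_trans (nearest_point_norm (u_near Dx) vP))// ler_wpM2l ?addr_ge0//.
  by rewrite (le_trans (ler_normB _ _))// lerD2l zZ.
have uN : `|u x| <= N + Z.
  rewrite -[u x](subrK (z x)) (le_trans (ler_normD _ _))// lerD// zZ//.
split; first by rewrite (le_trans uN)// lerDl.
  apply: (kkt_exists _ Uv _ (u_near Dx)); first exact: convex_input_set.
  exact: lt_le_trans slack.
move=> mu kktx; have := kkt_multiplier_le kktx Uv slack.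
rewrite -ler_pdivlMr// => /le_trans; apply.
apply: le_trans (_ : m%:R * N * (`|v| + (N + Z)) / (tau / 2) <= _); last first.
  by rewrite lerDr addr_ge0.
rewrite ler_pM2r ?invr_gt0// ler_pM ?mulr_ge0 ?ler_wpM2l//.
by rewrite (le_trans (ler_normB _ _))// lerD2l.
Qed.

(** With bounded points and multipliers, [kkt_distance] bounds the squared distance
    by a multiple of [|x - x0|]. *)
Lemma nearest_point_continuous e : 0 < e ->
  exists2 r, 0 < r & forall x, D x -> `|x - x0| < r -> `|u x - u x0| < e.
Proof.
move=> e0; have [r [L [M [r0 L0 M0 aL kktP]]]] := kkt_local.
have xx0 : `|x0 - x0| < r by rewrite subrr normr0.
pose K := L * (1 + m%:R) * (1 + M) * ((M + M) + (M + M)).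
have K0 : 0 <= K by rewrite !mulr_ge0 ?addr_ge0.
exists (Num.min r (e ^+ 2 / (K + 1))).
  by rewrite lt_min r0 divr_gt0 ?exprn_gt0 ?ltr_wpDl.
move=> x Dx; rewrite lt_min => /andP[xr]; rewrite ltr_pdivlMr ?ltr_wpDl// => xe.
have [uM [mu kktx] muM] := kktP _ Dx xr.
have [u0M [mu0 kkt0] mu0M] := kktP _ Dx0 xx0.
have [ax hx zx] := aL _ _ Dx Dx0 xr xx0.
rewrite -ltr_sqr ?nnegrE ?(ltW e0)//; apply: le_lt_trans xe.
have := kkt_distance kktx kkt0 L0 (normr_ge0 (x - x0)) u0M (mu0M _ kkt0) ax hx zx.
move=> /le_trans; apply.
have -> : `|x - x0| * (K + 1) =
  L * (1 + m%:R) * (1 + M) * `|x - x0| * ((M + M) + (M + M)) + `|x - x0|.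
  by rewrite /K; ring.
rewrite -[leLHS]addr0 lerD// ler_wpM2l ?mulr_ge0 ?addr_ge0//.
have mu_le nu y : KKT y nu -> nu <= M -> `|nu| <= M by move=> [_ nu0 _ _]; rewrite ger0_norm.
rewrite lerD// (le_trans (ler_normB _ _))// lerD//.
  exact: mu_le kktx (muM _ kktx).
exact: mu_le kkt0 (mu0M _ kkt0).
Qed.

(** This is where continuity at [x0] is used: it keeps an inactive barrier inactive,
    so that the multipliers vanish, and otherwise it keeps the nearest points close
    enough to [u x0] to move from them in the directions [w] and [- w]. *)
Lemma multiplier_lipschitz : exists r N, [/\ 0 < r, 0 <= N &
  forall x y mu nu, D x -> D y -> `|x - x0| < r -> `|y - x0| < r ->
    KKT x mu -> KKT y nu ->
    `|mu - nu| <= N * (`|u x - u y| + `|x - y|)].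
Proof.
have [r [L [M [r0 L0 M0 aL kktP]]]] := kkt_local.
have [[Uu0 /= ge0] _] := u_near Dx0.
have [slack0|le0] := ltP 0 (dot (a x0) (u x0) + h x0).
  have [r1 r1_gt0 slackP] :=
    lipschitz_at_cvg Dx0 (lipschitz_at_dot_addr (u x0)) (divr_gt0 slack0 (ltr0n _ 2)).
  have [r2 [Ma [r2_gt0 Ma0 aM]]] := lipschitz_at_bounded Dx0 a_lip.
  have mMa : 0 < m%:R * Ma + 1 by rewrite ltr_wpDl ?mulr_ge0.
  have [r3 r3_gt0 uP] := nearest_point_continuous
    (divr_gt0 (divr_gt0 slack0 (ltr0n _ 2)) mMa).
  have mu0 x mu : D x -> `|x - x0| < Num.min r1 (Num.min r2 r3) -> KKT x mu -> mu = 0.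
    move=> Dx; rewrite !lt_min => /and3P[x1 x2 x3] [_ _ /eqP + _].
    rewrite mulf_eq0 => /predU1P[//|/eqP slackx].
    have := slackP _ Dx x1; rewrite ltr_norml => /andP[+ _].
    have -> : dot (a x) (u x0) + h x = dot (a x) (u x0 - u x).
      by rewrite -[RHS]addr0 -slackx dotBr; ring.
    have := uP _ Dx x3; rewrite ltr_pdivlMr// distrC => u_close.
    have := ler_norm_dot (a x) (u x0 - u x).
    have : m%:R * `|a x| * `|u x0 - u x| <= m%:R * Ma * `|u x0 - u x|.
      by rewrite ler_wpM2r// ler_wpM2l// aM.
    have := ler_norm (dot (a x) (u x0 - u x)); have := normr_ge0 (u x0 - u x).
    move: u_close; rewrite mulrDr mulr1 (mulrC `|_|).
    move: (m%:R * Ma * _) (m%:R * _ * _) => s t; lra.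
  exists (Num.min r1 (Num.min r2 r3)), 0; split => //.
    by rewrite !lt_min r1_gt0 r2_gt0.
  move=> x y mu nu Dx Dy xr yr kktx kkty.
  by rewrite (mu0 _ _ Dx xr kktx) (mu0 _ _ Dy yr kkty) subrr normr0 mul0r.
have eq0 : dot (a x0) (u x0) + h x0 = 0 by apply/le_anti; rewrite le0.
have [w [aw Aw]] := transversal eq0.
have [e e0 eP] := active_direction_feasible Aw Uu0.
have [r1 r1_gt0 uP] := nearest_point_continuous e0.
have aw_lip : lipschitz_at D (fun x => dot (a x) w) x0.
  apply: (@lipschitz_at_entry _ _ _ _ _ (fun x => a x *m w)).
  by apply: lipschitz_at_mulmx => //; exact: lipschitz_at_cst.
have [r2 r2_gt0 awP] := lipschitz_at_cvg Dx0 aw_lip (divr_gt0 ltr01 (ltr0n R 2)).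
have dirP x mu : D x -> `|x - x0| < r1 -> KKT x mu ->
    mu * dot (a x) w = dot (u x - z x)^T w.
  move=> Dx xr kktx; apply: (kkt_direction kktx e0); apply: eP;
    rewrite ?normrN ?gtr0_norm//; [by case: kktx => -[]|exact/ltW/uP|
    by case: kktx => -[]|exact/ltW/uP].
exists (Num.min r (Num.min r1 r2)), (2 * m%:R * `|w| * (1 + L * (1 + M))).
split; [by rewrite !lt_min r0 r1_gt0|by rewrite !mulr_ge0 ?addr_ge0 ?mulr_ge0 ?addr_ge0|].
move=> x y mu nu Dx Dy; rewrite !lt_min => /and3P[xr xr1 xr2] /and3P[yr yr1 yr2].
move=> kktx kkty; have [ax _ zx] := aL _ _ Dx Dy xr yr.
have [_ _ nuM] := kktP _ Dy yr.
apply: multiplier_distance ax zx _ (dirP _ _ Dx xr1 kktx) (dirP _ _ Dy yr1 kkty) => //.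
- by case: kkty.
- exact: nuM.
by have := awP _ Dx xr2; rewrite aw ltr_norml => /andP[+ _]; lra.
Qed.

Lemma nearest_point_lipschitz_at : lipschitz_at D u x0.
Proof.
have [r [L [M [r0 L0 M0 aL kktP]]]] := kkt_local.
have [s [N [s0 N0 muN]]] := multiplier_lipschitz.
pose K := L * (1 + m%:R) * (1 + M).
have K0 : 0 <= K by rewrite !mulr_ge0 ?addr_ge0.
have KN0 : 0 <= K * (1 + N) by rewrite mulr_ge0 ?addr_ge0.
exists (Num.min r s), (K * (1 + N) + 1).
split; [by rewrite lt_min r0|by rewrite addr_ge0|].
move=> x y Dx Dy; rewrite !lt_min => /andP[xr xs] /andP[yr ys].
have [uM [mu kktx] muM] := kktP _ Dx xr.
have [vM [nu kkty] nuM] := kktP _ Dy yr.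
have [ax hx zx] := aL _ _ Dx Dy xr yr.
apply: sqr_le_self_bound => //.
have := kkt_distance kktx kkty L0 (normr_ge0 (x - y)) vM (nuM _ kkty) ax hx zx.
move=> /le_trans; apply; rewrite -/K.
have -> : K * (1 + N) * `|x - y| * (`|u x - u y| + `|x - y|) =
    K * `|x - y| * (`|u x - u y| + N * (`|u x - u y| + `|x - y|)) + K * `|x - y| ^+ 2.
  by ring.
rewrite -[leLHS]addr0; apply: lerD; last by rewrite mulr_ge0 ?sqr_ge0.
apply: ler_wpM2l; first exact: mulr_ge0.
by rewrite lerD2l; exact: muN.
Qed.

End ParametricProjection.

(** * The quadratic program *)

Section QuadraticProgram.
Context {R : realType} {n m p : nat}.
Variables (f : 'cV[R]_n -> 'cV[R]_n) (g : 'cV[R]_n -> 'M[R]_(n, m)).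
Variables (A : 'M[R]_(p, m)) (b : 'cV[R]_p) (B : 'cV[R]_n -> R).
Variables (alpha : R -> R) (udes : 'cV[R]_n -> 'cV[R]_m).
Let a := lie_g g B.
Let h x := lie_f f B x + alpha (B x).

Lemma barrier_lhsE x u : barrier_lhs f g B alpha x u = dot (a x) u + h x.
Proof. by rewrite /barrier_lhs addrAC addrC. Qed.

Lemma qp_feasibleE x :
  qp_feasible f g A b B alpha x = halfspace_cut (input_set A b) (a x) (h x).
Proof.
by apply/seteqP; split=> u [] /=; rewrite /qp_feasible /= barrier_lhsE.
Qed.

Lemma qp_objectiveE x u :
  qp_objective udes x u = 2^-1 * dot (u - udes x)^T (u - udes x).
Proof.
by rewrite /qp_objective dot_sqr; congr (_ * _); apply: eq_bigr => i _; rewrite !mxE.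
Qed.

Lemma qp_minimizerE x : qp_minimizer f g A b B alpha udes x =
  nearest_point (halfspace_cut (input_set A b) (a x) (h x)) (udes x).
Proof.
rewrite -qp_feasibleE; apply/seteqP; split=> u [Pu umin]; split => // v Pv.
  by have := umin v Pv; rewrite !qp_objectiveE ler_pM2l// invr_gt0.
by rewrite !qp_objectiveE ler_pM2l ?invr_gt0//; exact: umin.
Qed.

Lemma qp_law_nearest x : qp_feasible f g A b B alpha x !=set0 ->
  nearest_point (halfspace_cut (input_set A b) (a x) (h x)) (udes x)
    (qp_law f g A b B alpha udes x).
Proof.
rewrite qp_feasibleE => /(nearest_point_exists (udes x)); rewrite -qp_minimizerE.
exact: xgetPex.
Qed.

(** The active gradients are free, and the barrier gradient is one of them: take
    the dual vector of that member of the family. *)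
Lemma nondegenerate_transversal x u :
  free [seq constraint_grad g A B x k
       | k in active_constraints f g A b B alpha x u] ->
  dot (a x) u + h x = 0 ->
  exists w, dot (a x) w = 1 /\
    forall i, (A *m u + b) i 0 = 0 -> (A *m w) i 0 = 0.
Proof.
move=> active_free eq0.
have [|w [w1 w0]] := free_dual_vector (k0 := None) active_free.
  by rewrite inE barrier_lhsE eq0.
exists w; split => // i i0.
have := w0 (Some i); rewrite inE i0 eqxx => /(_ isT isT) /=.
by rewrite -row_mul mxE.
Qed.

End QuadraticProgram.

Theorem theorem2 (R : realType) (n m p : nat)
    (f : 'cV[R]_n -> 'cV[R]_n) (g : 'cV[R]_n -> 'M[R]_(n, m))
    (A : 'M[R]_(p, m)) (b : 'cV[R]_p)
    (B : 'cV[R]_n -> R) (C : set 'cV[R]_n)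
    (c d : \bar R) (alpha : R -> R)
    (udes : 'cV[R]_n -> 'cV[R]_m)
    (f_lip : lipschitz f)
    (g_lip : lipschitz g)
    (B_cbf : control_barrier_function f g (input_set A b) B C)
    (alpha_K : extended_class_K c d alpha)
    (alpha_dom : forall x, C x -> open_dom c d (B x))
    (udes_in : forall x, input_set A b (udes x))
    (gradB_lip : [locally [lipschitz (grad B x) | x in C]])
    (alpha_lip : [locally [lipschitz (alpha s) | s in open_dom c d]])
    (udes_lip : [locally [lipschitz (udes x) | x in C]])
    (rel_degree_one : forall x, C x -> lie_g g B x != 0)
    (nondegenerate : primal_nondegenerate f g A b B alpha udes C)
    (feasible : forall x, C x -> qp_feasible f g A b B alpha x !=set0) :
  [locally [lipschitz (qp_law f g A b B alpha udes x) | x in C]].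
Proof.
move/locally_lipschitzP in gradB_lip.
move/locally_lipschitzP in alpha_lip.
move/locally_lipschitzP in udes_lip.
apply/locally_lipschitzP => x0 Cx0.
have B_lip : lipschitz_at C B x0.
  by case: B_cbf => B_C1 _ _; exact: continuously_differentiable_lipschitz_at.
apply: (nearest_point_lipschitz_at (A := A) (b := b) Cx0
  (a := lie_g g B) (h := fun x => lie_f f B x + alpha (B x)) (z := udes)).
- apply: lipschitz_at_mulmx => //; first exact: gradB_lip.
  exact: lipschitz_at_setT.
- apply: lipschitz_atD.
    apply: (@lipschitz_at_entry _ _ _ _ _ (fun x => grad B x *m f x)).
    apply: lipschitz_at_mulmx => //; first exact: gradB_lip.
    exact: lipschitz_at_setT.
  apply: (@lipschitz_at_comp _ _ _ _ _ (open_dom c d)) => //.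
  exact/alpha_lip/alpha_dom.
- exact: udes_lip.
- by move=> x Cx; apply: qp_law_nearest; exact: feasible.
- exact/nondegenerate_transversal/nondegenerate.
Qed.
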